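(* The group $\Gamma_d(q)$ has infinitely many cone types with respect to the generating set $S_{d,q}$.
   Context: **The group.** $d\ge 2$ and $q\ge 2$ are integers such that either $d\in\{2,3\}$, or $d\ge4$ and every prime divisor of $q$ is greater than $d-1$. $\mathcal L_q$ is a commutative ring of order $q$ with unit $1$ containing distinct elements $\lambda_1,\dots,\lambda_{d-1}$ whose pairwise differences are invertible if $d\ge3$. Let $\mathcal R=\mathcal L_q[t,(t+\lambda_1)^{-1},\dots,(t+\lambda_{d-1})^{-1}]$. $\Gamma_d(q)$ is the group of matrices $\begin{pmatrix}(t+\lambda_1)^{k_1}\cdots(t+\lambda_{d-1})^{k_{d-1}}&P\\0&1\end{pmatrix}$ with $k_i\in\mathbb Z$, $P\in\mathcal R$. The generating set $S_{d,q}$ (closed under inverses) consists of the matrices $\begin{pmatrix}t+\lambda_i&b\\0&1\end{pmatrix}^{\pm1}$ ($b\in\mathcal L_q$, $1\le i\le d-1$) and $\begin{pmatrix}(t+\lambda_i)(t+\lambda_j)^{-1}&-b(t+\lambda_j)^{-1}\\0&1\end{pmatrix}$ ($b\in\mathcal L_q$, $i\ne j$ in $\{1,\dots,d-1\}$). **Cone types.** Let $G$ be a group with finite generating set $S$, and let $d(\cdot,\cdot)$ be the distance in the Cayley graph $\Gamma(G,S)$ (edges joining $g$ and $gs$). A path $p$ is outbound if $d(1,p(t))$ is a strictly increasing function of $t$. For $g\in G$, the cone at $g$, $C'(g)$, is the set of all outbound paths starting at $g$. The cone type of $g$ is $C(g)=g^{-1}C'(g)$. (Equivalently, in the discrete setting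 of edge paths, the cone type of $g$ is the set of words $s_1\cdots s_r$ in the generators such that the distance from the identity strictly increases at each step of the path $g, gs_1, gs_1s_2,\dots,gs_1\cdots s_r$.) *)

(* Defs.v *)
From HB Require Import structures.
From mathcomp Require Import all_boot all_order all_algebra.
From mathcomp Require Import all_classical.
From mathcomp Require Import ring.

Set Implicit Arguments.
Unset Strict Implicit.
Unset Printing Implicit Defensive.

Import GRing.Theory.
Local Open Scope classical_set_scope.
Local Open Scope quotient_scope.
Local Open Scope ring_scope.

(* Cayley graphs and cone types.  A path is the sequence of its vertices.     *)
Section ConeTypes.
Variables (G : groupType) (S : set G).

Definition cayley_edge : rel G := fun x y => (x^-1 * y)%g \in S.

(* Length of a shortest path from x to y; the junk value 0 is taken when y    *)
(* is not reachable from x, which does not happen if S generates G.           *)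
Definition cayley_dist (x y : G) : nat :=
  let walk n := `[< exists p, [/\ path cayley_edge x p, last x p = y
                                & size p = n] >] in
  if pselect (exists n, walk n) is left walk_ex then ex_minn walk_ex else 0%N.

Definition outbound_step : rel G := fun x y =>
  cayley_edge x y && (cayley_dist 1%g x < cayley_dist 1%g y)%N.

(* Outbound paths from g; translating them by g^-1 gives the cone type. *)
Definition cone (g : G) : set (seq G) :=
  [set g :: p | p in [set p | path outbound_step g p]].

Definition cone_type (g : G) : set (seq G) :=
  [set map (fun x => g^-1 * x)%g p | p in cone g].

End ConeTypes.

(* The ring L[t, (t + lam_i)^-1 | i < n] as the localization of {poly L}.     *)
(* The fraction P / prod_i (X + lam_i)^(k_i) is represented by (P, k).  Since *)
(* its denominator is monic, it is cancellable even if L has zero divisors.   *)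
Section Localization.
Variables (L : comNzRingType) (n : nat) (lam : 'I_n -> L).

Let frac := ({poly L} * {ffun 'I_n -> nat})%type.

Definition locden (k : {ffun 'I_n -> nat}) : {poly L} :=
  \prod_i ('X + (lam i)%:P) ^+ k i.

Lemma locden0 : locden 0 = 1.
Proof. by rewrite /locden big1 // => i _; rewrite ffunE expr0. Qed.

Lemma locdenD k l : locden (k + l) = locden k * locden l.
Proof.
by rewrite /locden -big_split; apply: eq_bigr => i _; rewrite ffunE exprD.
Qed.

Lemma locden_monic k : locden k \is monic.
Proof.
by apply: monic_prod => i _; apply: monic_exp; rewrite -[lam i]opprK polyCN
  monicXsubC.
Qed.

Lemma locdenI k : injective (fun P => P * locden k).
Proof. exact/monic_rreg/locden_monic. Qed.

Definition loceq (x y : frac) := x.1 * locden y.2 == y.1 * locden x.2.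

Fact loceq_refl : reflexive loceq. Proof. by move=> x; rewrite /loceq. Qed.

Fact loceq_sym : symmetric loceq.
Proof. by move=> x y; rewrite /loceq eq_sym. Qed.

Fact loceq_trans : transitive loceq.
Proof.
move=> y x z; rewrite /loceq => /eqP xy /eqP yz; apply/eqP/(@locdenI y.2) => /=.
by rewrite mulrAC xy mulrAC yz mulrAC.
Qed.

Canonical loceq_equiv := EquivRel loceq loceq_refl loceq_sym loceq_trans.

Definition locring := {eq_quot loceq}.
HB.instance Definition _ : EqQuotient _ loceq locring := EqQuotient.on locring.
HB.instance Definition _ := Choice.on locring.

Definition locfrac (P : {poly L}) (k : {ffun 'I_n -> nat}) : locring :=
  \pi_locring (P, k).

Lemma locfracP P k P' k' :
  locfrac P k = locfrac P' k' <-> P * locden k' = P' * locden k.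
Proof. by rewrite /locfrac; split=> [/eqmodP/eqP|/eqP] // ?; apply/eqmodP. Qed.

Lemma locfracE (x : locring) : {f : frac | x = locfrac f.1 f.2}.
Proof. by exists (repr x); rewrite /locfrac -surjective_pairing reprK. Qed.

Definition locop2 (f : frac -> frac -> frac) (x y : locring) : locring :=
  \pi_locring (f (repr x) (repr y)).

Let addf (x y : frac) : frac :=
  (x.1 * locden y.2 + y.1 * locden x.2, x.2 + y.2).
Let mulf (x y : frac) : frac := (x.1 * y.1, x.2 + y.2).

Let repr_locfrac P k :
  (repr (locfrac P k)).1 * locden k = P * locden (repr (locfrac P k)).2.
Proof. by apply/locfracP; rewrite /locfrac -surjective_pairing reprK. Qed.

Definition locadd := locop2 addf.
Definition locmul := locop2 mulf.
Definition locopp (x : locring) : locring :=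
  locfrac (- (repr x).1) (repr x).2.

Lemma locaddE P k P' k' :
  locadd (locfrac P k) (locfrac P' k')
    = locfrac (P * locden k' + P' * locden k) (k + k').
Proof.
apply/locfracP => /=; have := repr_locfrac P k; have := repr_locfrac P' k'.
move: (repr _) (repr _) => [Q l] [Q' l'] /= e' e; rewrite !locdenD.
transitivity (Q * locden k * (locden l' * locden k')
              + Q' * locden k' * (locden l * locden k)); first by ring.
by rewrite e e'; ring.
Qed.

Lemma locmulE P k P' k' :
  locmul (locfrac P k) (locfrac P' k') = locfrac (P * P') (k + k').
Proof.
apply/locfracP => /=; have := repr_locfrac P k; have := repr_locfrac P' k'.
move: (repr _) (repr _) => [Q l] [Q' l'] /= e' e; rewrite !locdenD.
by rewrite mulrACA e e' mulrACA.
Qed.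

Lemma locoppE P k : locopp (locfrac P k) = locfrac (- P) k.
Proof. by apply/locfracP; rewrite !mulNr repr_locfrac. Qed.

Let locE := (locaddE, locmulE, locoppE).

Ltac locsolve :=
  rewrite ?locE; apply/locfracP; rewrite ?locdenD ?locden0; ring.

Fact locaddA : associative locadd.
Proof.
by move=> x y z; case: (locfracE x) (locfracE y) (locfracE z)
  => [? ->] [? ->] [? ->]; locsolve.
Qed.

Fact locaddC : commutative locadd.
Proof.
by move=> x y; case: (locfracE x) (locfracE y) => [? ->] [? ->]; locsolve.
Qed.

Fact locadd0 : left_id (locfrac 0 0) locadd.
Proof. by move=> x; case: (locfracE x) => [? ->]; locsolve. Qed.

Fact locaddN : left_inverse (locfrac 0 0) locopp locadd.
Proof. by move=> x; case: (locfracE x) => [? ->]; locsolve. Qed.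

HB.instance Definition _ :=
  GRing.isZmodule.Build locring locaddA locaddC locadd0 locaddN.

Fact locmulA : associative locmul.
Proof.
by move=> x y z; case: (locfracE x) (locfracE y) (locfracE z)
  => [? ->] [? ->] [? ->]; locsolve.
Qed.

Fact locmulC : commutative locmul.
Proof.
by move=> x y; case: (locfracE x) (locfracE y) => [? ->] [? ->]; locsolve.
Qed.

Fact locmul1 : left_id (locfrac 1 0) locmul.
Proof. by move=> x; case: (locfracE x) => [? ->]; locsolve. Qed.

Fact locmulD : left_distributive locmul locadd.
Proof.
by move=> x y z; case: (locfracE x) (locfracE y) (locfracE z)
  => [? ->] [? ->] [? ->]; locsolve.
Qed.

Fact loc1_neq0 : locfrac 1 0 != locfrac 0 0.
Proof.
by apply/eqP => /locfracP/eqP; rewrite locden0 !mulr1 oner_eq0.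
Qed.

HB.instance Definition _ := GRing.Zmodule_isComNzRing.Build locring
  locmulA locmulC locmul1 locmulD loc1_neq0.

Definition locunit : {pred locring} := fun x => `[< exists y, y * x = 1 >].
Definition locinv (x : locring) : locring :=
  if x \in locunit then xget x [set y | y * x = 1] else x.

Fact locmulV : {in locunit, left_inverse 1 locinv *%R}.
Proof.
move=> x Ux; rewrite /locinv Ux; case/asboolP: Ux => y yx1.
exact: (xgetI x (yx1 : [set y | y * x = 1] y)).
Qed.

Fact locunitP (x y : locring) : y * x = 1 -> locunit x.
Proof. by move=> yx1; apply/asboolP; exists y. Qed.

Fact locinv_out : {in [predC locunit], locinv =1 id}.
Proof. by move=> x /negbTE Ux; rewrite /locinv Ux. Qed.

HB.instance Definition _ := GRing.ComNzRing_hasMulInverse.Build locring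
  locmulV locunitP locinv_out.

Definition locpoly (P : {poly L}) : locring := locfrac P 0.

Fact locpoly_is_zmod_morphism : zmod_morphism locpoly.
Proof.
move=> P Q; rewrite /locpoly -[RHS]/(locadd _ (locopp _)).
by rewrite !locE !locden0 !mulr1 addr0.
Qed.

Fact locpoly_is_monoid_morphism : monoid_morphism locpoly.
Proof.
by split=> // P Q; rewrite /locpoly -[RHS]/(locmul _ _) locmulE addr0.
Qed.

HB.instance Definition _ := GRing.isZmodMorphism.Build {poly L} locring
  locpoly locpoly_is_zmod_morphism.
HB.instance Definition _ := GRing.isMonoidMorphism.Build {poly L} locring
  locpoly locpoly_is_monoid_morphism.

(* The constants b and the units t + lam_i of locring. *)
Definition locC (b : L) : locring := locpoly b%:P.
Definition loctD (i : 'I_n) : locring := locpoly ('X + (lam i)%:P).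

Lemma loctD_unit i : loctD i \is a GRing.unit.
Proof.
pose k := [ffun j => (j == i) : nat]; have kE : locden k = 'X + (lam i)%:P.
  rewrite /locden (bigD1 i) //= big1 => [|j /negbTE ji];
    by rewrite ffunE ?eqxx ?ji ?expr1 ?mulr1.
apply: (@locunitP _ (locfrac 1 k)).
rewrite -[LHS]/(locmul _ _) locmulE; apply/locfracP.
by rewrite locden0 addr0 kE !mul1r mulr1.
Qed.

Lemma locpoly_inj : injective locpoly.
Proof. by move=> P Q /locfracP; rewrite !locden0 !mulr1. Qed.

Lemma locfrac_div P k : locfrac P k = locpoly P / \prod_i loctD i ^+ k i.
Proof.
have -> : \prod_i loctD i ^+ k i = locpoly (locden k).
  by rewrite rmorph_prod; apply: eq_bigr => i _; rewrite rmorphXn.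
have Uk : locpoly (locden k) \is a GRing.unit.
  rewrite rmorph_prod; apply: rpred_prod => i _.
  by rewrite rmorphXn unitrX ?loctD_unit.
apply: (mulIr Uk); rewrite divrK // -[LHS]/(locmul _ _) locmulE.
by apply/locfracP; rewrite addr0 locden0 mulr1.
Qed.

End Localization.

Section AffineMatrix.
Variable R : comUnitRingType.

Definition affmx (a b : R) : 'M[R]_2 :=
  block_mx (a%:M : 'M_1) (b%:M : 'M_1) (0 : 'M_1) (1%:M : 'M_1).

Lemma affmx1 : affmx 1 0 = 1.
Proof. by rewrite /affmx raddf0 -scalar_mx_block. Qed.

Lemma affmxM a b a' b' :
  affmx a b * affmx a' b' = affmx (a * a') (a * b' + b).
Proof.
apply: etrans (@mulmx_block _ 1 1 1 1 1 1 _ _ _ _ _ _ _ _) _.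
rewrite !mulmx0 !mul0mx !mulmx1 !addr0 add0r.
by rewrite -!scalar_mxM -raddfD.
Qed.

End AffineMatrix.

(* For lam_i indexed by i < d - 1, the group Gamma_d(q) with q = #|L|, and    *)
(* its generating set S_{d,q}.                                                *)
Section DiestelLeaderGroup.
Variables (L : comNzRingType) (n : nat) (lam : 'I_n -> L).

Local Notation R := (locring lam).

Definition gamma_mx : {pred 'M[R]_2} := fun M =>
  `[< exists (k : 'I_n -> int) (P : R),
        M = affmx (\prod_i loctD lam i ^ k i) P >].

Fact gamma_mx1 : 1 \in gamma_mx.
Proof.
by apply/asboolP; exists (fun=> 0), 0; rewrite big1 // affmx1.
Qed.

Fact gamma_mxM M N : M \in gamma_mx -> N \in gamma_mx -> M * N \in gamma_mx.
Proof.
move=> /asboolP[k [P ->]] /asboolP[k' [P' ->]]; apply/asboolP.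
rewrite affmxM -big_split /=; exists (fun i => k i + k' i); eexists.
by congr affmx; apply: eq_bigr => i _; rewrite exprzDr ?loctD_unit.
Qed.

Let gamma_mx_inv M : M \in gamma_mx ->
  exists2 N, N \in gamma_mx & N * M = 1.
Proof.
move=> /asboolP[k [P ->]]; pose a' := \prod_i loctD lam i ^ (- k i).
exists (affmx a' (- (a' * P))); first by apply/asboolP; do 2!eexists.
rewrite affmxM subrr -big_split -affmx1; congr affmx; apply: big1 => i _ /=.
by rewrite -exprzDr ?loctD_unit // addNr.
Qed.

Fact gamma_mxU M : M \in gamma_mx -> M \is a GRing.unit.
Proof. by case/gamma_mx_inv => N _ /mulmx1_unit[]. Qed.

Fact gamma_mxV M : M \in gamma_mx -> M^-1 \in gamma_mx.
Proof.
move=> GM; case: (gamma_mx_inv GM) => N GN NM1.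
by rewrite -[M^-1]mul1r -NM1 mulrK ?gamma_mxU.
Qed.

Record gamma := Gamma { gamma_val :> 'M[R]_2; _ : gamma_val \in gamma_mx }.

HB.instance Definition _ := [isSub for gamma_val].
HB.instance Definition _ := [Choice of gamma by <:].

Let gamma_valP (g : gamma) : (g : 'M__) \in gamma_mx := valP g.

Definition gamma_one : gamma := Gamma gamma_mx1.
Definition gamma_mul (g h : gamma) : gamma :=
  Gamma (gamma_mxM (gamma_valP g) (gamma_valP h)).
Definition gamma_inv (g : gamma) : gamma := Gamma (gamma_mxV (gamma_valP g)).

Fact gamma_mulA : associative gamma_mul.
Proof. by move=> g h k; apply: val_inj; apply: mulrA. Qed.

Fact gamma_mul1g : left_id gamma_one gamma_mul.
Proof. by move=> g; apply: val_inj; apply: mul1r. Qed.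

Fact gamma_mulg1 : right_id gamma_one gamma_mul.
Proof. by move=> g; apply: val_inj; apply: mulr1. Qed.

Fact gamma_mulVg : left_inverse gamma_one gamma_inv gamma_mul.
Proof. by move=> g; apply/val_inj/mulVr/gamma_mxU/gamma_valP. Qed.

Fact gamma_mulgV : right_inverse gamma_one gamma_inv gamma_mul.
Proof. by move=> g; apply/val_inj/mulrV/gamma_mxU/gamma_valP. Qed.

HB.instance Definition _ := isGroup.Build gamma
  gamma_mulA gamma_mul1g gamma_mulg1 gamma_mulVg gamma_mulgV.

Definition gamma_gen : set gamma := [set g |
  (exists (i : 'I_n) (b : L),
     gamma_val g = affmx (loctD lam i) (locC lam b) \/
     gamma_val g = (affmx (loctD lam i) (locC lam b))^-1) \/
  (exists (i j : 'I_n) (b : L), i != j /\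
     gamma_val g = affmx (loctD lam i / loctD lam j)
                         (- locC lam b / loctD lam j))].

End DiestelLeaderGroup.

Arguments gamma_gen {L n} lam.

(* Main.v *)
(* With n = d - 1, write (k, P) for the matrix with diagonal part             *)
(* (t + lam_0)^(k_0) ... (t + lam_(n-1))^(k_(n-1)) and translation part P.    *)
(* The heights k_i and - sum_i k_i are the levels in the d trees of the       *)
(* Diestel-Leader graph: a generator raises one by 1 and lowers another by 1, *)
(* and changes P only by terms that are as integral at each place t + lam_i,  *)
(* 1/t as the heights of its endpoints.                                       *)
(*   Take P = sum_i (t + lam_i)^(-k) + (t + lam_0)^k, which has a pole of     *)
(* order k at each place.  Every height must then drop to - k on the way from *)
(* 1 to (0, P), which costs (d + 2) k steps.  But explicit walks lead to      *)
(* (k e_0, P) and to (- k e_0, P) in (d + 1) k steps, up to an additive       *)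
(* constant.  Along the path (k e_0, P) s^j, 0 <= j <= 2 k, where             *)
(* s = (- e_0, 0), the length thus grows by k, up to this constant, in the    *)
(* first k steps, and then returns to its initial value.  Hence it contains   *)
(* long outbound paths along s that cannot be continued indefinitely, whose   *)
(* lengths are unbounded as k grows.                                          *)

From HB Require Import structures.
Require Import Defs.
From mathcomp Require Import all_boot all_order all_algebra.
From mathcomp Require Import all_classical.
From mathcomp Require Import ring zify.

Set Implicit Arguments.
Unset Strict Implicit.
Unset Printing Implicit Defensive.

Import Order.TTheory GRing.Theory Num.Theory.
Local Open Scope classical_set_scope.
Local Open Scope ring_scope.

(** If there were only finitely many cone types, the rays in a fixed direction [s] that eventually
    stop being outbound would stop within a common bound ([infinite_cone_types]). Arbitrarily long
    rays that do stop come from comparing word lengths along one line in direction [s]: its midpoint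
    [el 0 (far K)] has length at least [(n + 3) * K], while the points [K] steps before and after it
    have length at most [(n + 2) * K] plus a constant ([walk_far]). Since length changes by at most
    one per step, the ascent to the midpoint is nearly as steep as possible, so it contains long
    increasing stretches, and the later descent ends them ([long_run]).

    The lower bound ([walk_heights]) joins an ultrametric argument with a count: a pole of order [K]
    at each of the [n + 1] places forces every height down to [- K], and heights that start and end
    at 0 and always sum to 0 pay for this with [heights_bound]. *)

(** * Counting descents of a closed height profile *)

Section Heights.
Variables (X : finType) (N : nat) (H : nat -> X -> int).

Lemma descent_le (s t : nat) (d : nat -> X -> nat) x :
    (forall r, (s <= r < t)%N -> H r x - H r.+1 x <= (d r x)%:Z) -> (s <= t)%N ->
  H s x - H t x <= (\sum_(s <= r < t) d r x)%N%:Z.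
Proof.
move=> Hd; elim: t Hd => [|t IH] Hd st.
  by move: st; rewrite leqn0 => /eqP->; rewrite big_geq // subrr.
move: st; rewrite leq_eqVlt => /predU1P[->|st]; first by rewrite big_geq // subrr.
rewrite big_nat_recr //=.
have IH' : H s x - H t x <= (\sum_(s <= r < t) d r x)%N%:Z.
  by apply: IH => // r rt; apply: Hd; lia.
have : H t x - H t.+1 x <= (d t x)%:Z by apply: Hd; lia.
lia.
Qed.

(* Let t x be a time at which coordinate x is at most - k, and let s and s'   *)
(* be the least and the largest of these times.  Coordinate x descends by at  *)
(* least H s x + k between s and t x, and by at least H s' x after s'; these  *)
(* bounds add up to #|X| * k.  The first coordinate to be low has also        *)
(* descended by k before s, and for the last one the bound after s' improves  *)
(* from H s' x <= - k to 0.                                                   *)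
Lemma heights_bound (k : nat) (x0 : X) :
    (forall x, H 0 x = 0) -> (forall x, H N x = 0) ->
    (forall t, \sum_x H t x = 0) ->
    (forall t, (t < N)%N -> exists y, forall x, H t x - H t.+1 x <= (x == y)%:Z) ->
    (forall x, exists2 t, (t <= N)%N & H t x <= - k%:Z) ->
  ((#|X| + 2) * k <= N)%N.
Proof.
move=> H0 HN Hsum Hstep Hlow.
have [tm tmN tmk] : exists2 tm : X -> nat, forall x, (tm x <= N)%N &
    forall x, H (tm x) x <= - k%:Z.
  have tP x : exists t, (t <= N)%N /\ H t x <= - k%:Z by have [t] := Hlow x; exists t.
  by exists (fun x => projT1 (cid (tP x))) => x; case: (cid (tP x)) => t [].
pose d t x : nat := (0 < H t x - H t.+1 x)%R.
have dle x t : (t < N)%N -> H t x - H t.+1 x <= (d t x)%:Z.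
  by move=> /Hstep[y /(_ x)]; rewrite /d; case: eqP; case: ltP => /=; lia.
have dsum t : (t < N)%N -> (\sum_x d t x <= 1)%N.
  move=> /Hstep[y yP]; rewrite (bigD1 y) //= big1 ?addn0 ?leq_b1 // => x.
  by move=> /negbTE xy; have := yP x; rewrite /d xy; case: ltP => //=; lia.
pose D x := (\sum_(0 <= t < N) d t x)%N.
have DN : (\sum_x D x <= N)%N.
  rewrite /D exchange_big /= -[leqRHS]subn0 -[leqRHS]muln1 -sum_nat_const_nat.
  by rewrite big_nat [leqRHS]big_nat; apply: leq_sum => t /andP[_]; apply: dsum.
have [x1 _ x1min] := arg_minnP tm (isT : xpredT x0).
have [x2 _ x2max] := arg_maxnP tm (isT : xpredT x0).
have Dx x : k%:Z + H (tm x1) x + H (tm x2) x + k%:Z * (x == x1)%:Z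
    + k%:Z * (x == x2)%:Z <= (D x)%:Z.
  have t1 := x1min x isT; have t2 := x2max x isT.
  have -> : D x = (\sum_(0 <= r < tm x1) d r x + (\sum_(tm x1 <= r < tm x) d r x
      + (\sum_(tm x <= r < tm x2) d r x + \sum_(tm x2 <= r < N) d r x)))%N.
    by rewrite /D -!big_cat_nat // ?(leq_trans t1) // (leq_trans t2).
  have B s t : (s <= t)%N -> (t <= N)%N -> H s x - H t x <= (\sum_(s <= r < t) d r x)%N%:Z.
    by move=> st tN; apply: descent_le => // r rP; apply: dle; lia.
  have := B 0%N (tm x1); have := B _ _ t1; have := B _ _ t2; have := B (tm x2) N.
  have := tmk x; have := tmN x; have := tmN x1; have := tmN x2; have := H0 x; have := HN x.
  have k1 : x = x1 -> H (tm x1) x <= - k%:Z by move=> ->.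
  have k2 : x = x2 -> H (tm x2) x <= - k%:Z by move=> ->.
  by case: (x =P x1) => [/k1|_]; case: (x =P x2) => [/k2|_] /=; lia.
have : \sum_x (k%:Z + H (tm x1) x + H (tm x2) x + k%:Z * (x == x1)%:Z
    + k%:Z * (x == x2)%:Z) <= \sum_x (D x)%:Z by apply: ler_sum => x _.
have one y : \sum_x k%:Z * (x == y)%:Z = k%:Z.
  by rewrite (bigD1 y) //= eqxx big1 => [|x /negbTE->]; rewrite ?mulr0 ?addr0 ?mulr1.
(* At a fixed time the heights sum to zero, so both height terms vanish and [(#|X| + 2) * k]
   remains. *)
rewrite !big_split /= !Hsum !one sumr_const cardT -cardE.
rewrite -(big_morph Posz PoszD (erefl 0)).
move: DN; set S := (\sum_x D x)%N => SN.
by rewrite -mulr_natr natz; lia.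
Qed.

End Heights.

(** * Increasing runs of a sequence with steps at most one *)

Section Runs.
Variables (f : nat -> nat).
Hypothesis f_step : forall t, (f t.+1 <= (f t).+1)%N.

Lemma step_add a j : (f (a + j) <= f a + j)%N.
Proof.
elim: j => [|j IH]; first by rewrite !addn0.
by rewrite addnS; have := f_step (a + j); lia.
Qed.

(** Cut the first [K] steps into [C.+1] blocks of length [J.+1]. If no block were strictly
    increasing, each would lose at least one from the maximal gain, in total more than the allowed
    defect [C]. A run that never stopped would make [f (2 * K)] exceed [M], because [C < K]. *)
Lemma long_run (J C M : nat) : 
  let K := (J.+1 * C.+1)%N in
    (f 0 <= M)%N -> (M + K <= f K + C)%N -> (f (2 * K) <= M)%N ->
  exists a, (forall j, (j < J)%N -> (f (a + j) < f (a + j).+1)%N) /\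
            exists m, (f (a + m).+1 <= f (a + m))%N.
Proof.
move=> K f0 fK f2K.
have [a aK arun] : exists2 a, (a <= K)%N &
    forall j, (j < J.+1)%N -> (f (a + j) < f (a + j).+1)%N.
  apply: contrapT => norun.
  suff : forall c, (c <= C.+1)%N -> (f (J.+1 * c) + c <= f 0 + J.+1 * c)%N.
    by move=> /(_ _ (leqnn _)); rewrite -/K; lia.
  elim=> [|c IH] cC; first by rewrite muln0 addn0.
  have : ~ forall j, (j < J.+1)%N -> (f (J.+1 * c + j) < f (J.+1 * c + j).+1)%N.
    move=> run; apply: norun; exists (J.+1 * c)%N => //.
    by rewrite leq_mul2l /= ltnW.
  move=> /existsNP[j /not_implyP[jJ /negP]]; rewrite -leqNgt => jP.
  have := IH (ltnW cC).
  have := step_add (J.+1 * c) j.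
  have := step_add (J.+1 * c + j).+1 (J - j).
  have -> : ((J.+1 * c + j).+1 + (J - j) = J.+1 * c.+1)%N by lia.
  lia.
exists a; split=> [j jJ|]; first exact/arun/ltnW.
apply: contrapT => nostop.
have up j : (f a + j <= f (a + j))%N.
  elim: j => [|j IH]; first by rewrite !addn0.
  have /negP : ~ (f (a + j).+1 <= f (a + j))%N by move=> ?; apply: nostop; exists j.
  by rewrite !addnS; lia.
have := up (2 * K - a)%N; rewrite subnKC; last by lia.
have := step_add a (K - a); rewrite subnKC //.
have : (C < K)%N by rewrite /K; lia.
lia.
Qed.

End Runs.

(** * Cone types detected on rays *)

Section ConeTypeRays.
Variables (G : groupType) (S : set G).
Implicit Types (x y z g s : G).

Definition walk x y (m : nat) :=
  exists p, [/\ path (cayley_edge S) x p, last x p = y & size p = m].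

Lemma walk0 x : walk x x 0. Proof. by exists [::]. Qed.

Lemma walk_trans y x z a b : walk x y a -> walk y z b -> walk x z (a + b).
Proof.
move=> [p [pp pl ps]] [r [rp rl rs]]; exists (p ++ r).
by rewrite cat_path pp last_cat pl rp size_cat ps rs.
Qed.

Lemma walk_gen x s : S s -> walk x (x * s)%g 1.
Proof.
move=> Ss; exists [:: (x * s)%g]; split=> //=.
by rewrite /cayley_edge andbT mulKg; apply/mem_set.
Qed.

Lemma dist_le x y m : walk x y m -> (cayley_dist S x y <= m)%N.
Proof.
move=> w; rewrite /cayley_dist; case: pselect => // e.
by case: ex_minnP => r _; apply; apply/asboolP.
Qed.

Lemma distP x y m : walk x y m -> walk x y (cayley_dist S x y).
Proof.
move=> w; rewrite /cayley_dist; case: pselect => [e|[]].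
  by case: ex_minnP => r /asboolP.
by exists m; apply/asboolP.
Qed.

Definition ray s (j : nat) : seq G := [seq (s ^+ i)%g | i <- iota 0 j.+1].

Lemma ray_cone_type g s j : S s ->
  cone_type S g (ray s j) <->
  forall i, (i < j)%N ->
    (cayley_dist S 1%g (g * s ^+ i)%g < cayley_dist S 1%g (g * s ^+ i.+1)%g)%N.
Proof.
move=> Ss; have rayE : [seq (g * x)%g | x <- ray s j]
    = g :: [seq (g * s ^+ i)%g | i <- iota 1 j].
  by rewrite /ray /= mulg1; congr cons; apply/esym/(seq.map_comp (fun x => g * x)%g).
apply: (@iff_trans _ (path (outbound_step S) g [seq (g * s ^+ i)%g | i <- iota 1 j])).
  split=> [[_ [p pp <-]] /(congr1 (map (fun x => g * x)%g))|pp].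
    by rewrite rayE -seq.map_comp map_id_in => [[<-]//|x _ /=]; rewrite mulVKg.
  exists (g :: [seq (g * s ^+ i)%g | i <- iota 1 j]); first by eexists; first exact: pp.
  by rewrite -rayE -seq.map_comp map_id_in // => x _ /=; rewrite mulKg.
have edge i : cayley_edge S (g * s ^+ i)%g (g * s ^+ i.+1)%g.
  by rewrite /cayley_edge expgSr (mulgA g) mulKg; apply/mem_set.
split=> [/(pathP g) + i ij|up].
  rewrite size_map size_iota => /(_ _ ij) /andP[_].
  rewrite (nth_map 0%N) ?size_iota // nth_iota // add1n.
  by case: i ij => [|i] ij; rewrite /= ?mulg1 // (nth_map 0%N) ?size_iota ?nth_iota // ltnW.
apply/(pathP g) => i; rewrite size_map size_iota => ij.
have := up _ ij; have := edge i; rewrite /outbound_step.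
rewrite (nth_map 0%N) ?size_iota // nth_iota // add1n.
case: i ij => [|i] ij; rewrite /= ?mulg1; first by move=> -> ->.
by rewrite (nth_map 0%N) ?size_iota ?nth_iota ?(ltnW ij) // => -> ->.
Qed.

Lemma infinite_cone_types s : S s ->
    (forall J, exists g,
      (forall j, (j < J)%N ->
        (cayley_dist S 1%g (g * s ^+ j)%g < cayley_dist S 1%g (g * s ^+ j.+1)%g)%N) /\
      exists m,
        (cayley_dist S 1%g (g * s ^+ m.+1)%g <= cayley_dist S 1%g (g * s ^+ m)%g)%N) ->
  infinite_set [set cone_type S g | g in [set: G]].
Proof.
move=> Ss runs /finite_seqP[A AE].
(* [M] bounds, over the finitely many cone types missing some ray, the length of one missing ray; a
   ray outbound for [M] steps that later stops contradicts this. *)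
have [M MP] : exists M, forall C, C \in A -> (exists m, ~ C (ray s m)) ->
    exists2 m, (m <= M)%N & ~ C (ray s m).
  elim: (A) => [|C B [M MP]]; first by exists 0%N.
  have [[m Cm]|nC] := pselect (exists m, ~ C (ray s m)).
    exists (maxn m M) => C'; rewrite inE => /predU1P[->|/MP{}MP /MP[m' m'M C'm']].
      by exists m => //; apply: leq_maxl.
    by exists m' => //; rewrite leq_max m'M orbT.
  by exists M => C'; rewrite inE => /predU1P[->|/MP].
have [g [gup [m gm]]] := runs M.
have gA : cone_type S g \in A.
  suff : [set` A] (cone_type S g) by [].
  by rewrite -AE; exists g.
have [|r rM] := MP _ gA.
  by exists m.+1 => /(ray_cone_type _ _ Ss)/(_ m (leqnn _)); rewrite ltnNge gm.
by apply; apply/(ray_cone_type _ _ Ss) => i ir; apply: gup; apply: leq_trans rM.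
Qed.

End ConeTypeRays.

(** * Monomials and valuations at the [n + 1] places *)

Section Monomials.
Variables (L : comUnitRingType) (n : nat) (lam : 'I_n -> L).
Local Notation R := (locring lam).
Implicit Types (k l : {ffun 'I_n -> int}) (x : option 'I_n).

Definition mon k : R := \prod_i loctD lam i ^ k i.

Lemma mon0 : mon 0 = 1.
Proof. by rewrite /mon big1 // => i _; rewrite ffunE. Qed.

Lemma monD k l : mon (k + l) = mon k * mon l.
Proof.
rewrite /mon -big_split; apply: eq_bigr => i _ /=.
by rewrite ffunE exprzDr ?loctD_unit.
Qed.

Lemma monVl k : mon (- k) * mon k = 1.
Proof. by rewrite -monD addNr mon0. Qed.

Definition delta (i : 'I_n) : {ffun 'I_n -> int} := [ffun j => (j == i)%:Z].

Lemma mon_delta i : mon (delta i) = loctD lam i.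
Proof.
rewrite /mon (bigD1 i) //= big1 => [|j /negbTE ji]; rewrite ffunE ?ji ?eqxx //.
by rewrite expr1z mulr1.
Qed.

Lemma mon_deltaN i : mon (- delta i) = (loctD lam i)^-1.
Proof.
apply: (mulIr (loctD_unit lam i)); rewrite mulVr ?loctD_unit //.
by rewrite -mon_delta monVl.
Qed.

Lemma mon_nat (a : {ffun 'I_n -> nat}) :
  mon [ffun i => (a i)%:Z] = locpoly lam (locden lam a).
Proof.
rewrite /mon /locden rmorph_prod; apply: eq_bigr => i _.
by rewrite ffunE rmorphXn.
Qed.

Lemma mon_ge0 k : (forall i, 0 <= k i) ->
  mon k = locpoly lam (locden lam [ffun i => `|k i|%N]).
Proof.
by move=> k0; rewrite -mon_nat; congr mon; apply/ffunP => i; rewrite !ffunE gez0_abs.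
Qed.

Definition height x k : int := if x is Some i then k i else - \sum_i k i.

Arguments height : simpl never.

Lemma heightD x k l : height x (k + l) = height x k + height x l.
Proof.
rewrite /height; case: x => [i|]; first by rewrite ffunE.
rewrite -opprD -big_split /=; congr (- _); apply: eq_bigr => i _.
by rewrite ffunE.
Qed.

Lemma height0 x : height x 0 = 0.
Proof.
rewrite /height; case: x => [i|]; first by rewrite ffunE.
by rewrite big1 ?oppr0 // => i _; rewrite ffunE.
Qed.

Lemma heightN x k : height x (- k) = - height x k.
Proof. by apply: (addrI (height x k)); rewrite -heightD !subrr height0. Qed.

Lemma heightMn x k m : height x (k *+ m) = height x k *+ m.
Proof. by elim: m => [|m IH]; rewrite ?mulr0n ?height0 // !mulrS heightD IH. Qed.

Lemma height_delta x i : height x (delta i) = (x == Some i)%:Z - (x == None)%:Z.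
Proof.
rewrite /height; case: x => [j|]; first by rewrite ffunE subr0.
rewrite sub0r (bigD1 i) //= big1 => [|j /negbTE ji]; rewrite ffunE ?eqxx ?ji //.
Qed.

Lemma sum_height k : \sum_x height x k = 0.
Proof.
rewrite (bigD1 None) //= (reindex_omap Some id) /=; last by case.
by rewrite [X in _ + X](eq_bigl xpredT) ?addNr // => i; rewrite eqxx.
Qed.

Lemma size_locden (a : {ffun 'I_n -> nat}) :
  size (locden lam a) = (\sum_i a i).+1.
Proof.
rewrite /locden; pose P (p : {poly L}) (m : nat) := p \is monic /\ size p = m.+1.
suff [] : P (\prod_i ('X + (lam i)%:P) ^+ a i) (\sum_i a i)%N by [].
have PX i : P ('X + (lam i)%:P) 1.
  rewrite /P -[lam i]opprK polyCN; split; first exact: monicXsubC.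
  exact: size_XsubC.
have PM p q m m' : P p m -> P q m' -> P (p * q) (m + m')%N.
  move=> [pm ps] [qm qs]; split; first exact: rpredM.
  by rewrite size_monicM ?monic_neq0 // ps qs addSn addnS.
have P1 : P 1 0%N by split; rewrite ?monic1 ?size_poly1.
elim/big_ind2: _ => //= [p m q m' |i _]; first exact: PM.
by elim: (a i) => [|m IH]; rewrite ?expr0 // exprS -add1n; apply: PM.
Qed.

(* The balls around 0 of radius exp (- m) for the (t + lam_i)-adic valuation, *)
(* if x = Some i, and for minus the degree, if x = None.                      *)
Definition ball x (m : int) (r : R) : Prop := exists (P : {poly L}) k,
  r = locpoly lam P * mon k /\
  m + (if x is None then (size P)%:Z - 1 else 0) <= height x k.

(** The ultrametric inequality: both terms are written over the monomial with the pointwise minimal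
    exponents [l], and moving the difference into the polynomial raises its size by no more than the
    height at infinity gains. *)
Lemma ballD x m r r' : ball x m r -> ball x m r' -> ball x m (r + r').
Proof.
move=> [P [k [-> Pk]]] [P' [k' [-> Pk']]].
have [l [lk lk' lmin]] : exists l : {ffun 'I_n -> int}, [/\ forall i, l i <= k i,
    forall i, l i <= k' i & forall i, m <= k i -> m <= k' i -> m <= l i].
  exists [ffun i => Num.min (k i) (k' i)].
  by split=> i; rewrite ffunE ?ge_min ?lexx ?orbT // => mk mk'; rewrite le_min mk mk'.
pose a (h : {ffun 'I_n -> int}) : {ffun 'I_n -> nat} := [ffun i => absz ((h - l)%R i)].
have monE (h : {ffun 'I_n -> int}) : (forall i, l i <= h i) ->
    mon h = locpoly lam (locden lam (a h)) * mon l.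
  move=> lh; rewrite -mon_ge0 => [|i]; last by rewrite !ffunE subr_ge0.
  by rewrite -monD subrK.
exists (P * locden lam (a k) + P' * locden lam (a k')), l; split.
  by rewrite (monE k) // (monE k') // rmorphD !rmorphM /=; ring.
have sizeP (Q : {poly L}) (h : {ffun 'I_n -> int}) : (forall i, l i <= h i) ->
    ((size (Q * locden lam (a h)))%:Z <= (size Q)%:Z + (height None l - height None h) :> int)%R.
  move=> lh; have := size_polyMleq Q (locden lam (a h)); rewrite size_locden addnS /=.
  have -> : - (\sum_(i < n) l i) - - (\sum_(i < n) h i) = (\sum_(i < n) a h i)%N%:Z.
    rewrite opprK addrC -sumrB (big_morph Posz PoszD (erefl 0)); apply: eq_bigr => i _.
    by rewrite !ffunE gez0_abs ?subr_ge0.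
  by rewrite -PoszD lez_nat.
case: x Pk Pk' => [i|] /=; first by rewrite !addr0; apply: lmin.
have := size_polyD (P * locden lam (a k)) (P' * locden lam (a k')).
have := sizeP P _ lk; have := sizeP P' _ lk'.
move: (size (P * _)) (size (P' * _)) (size (polyseq (_ + _))) (size P) (size P').
lia.
Qed.

Lemma ball_scale x m b r : ball x m r -> ball x m (locC lam b * r).
Proof.
move=> [P [k [-> Pk]]]; exists (b%:P * P), k; split.
  by rewrite rmorphM mulrA.
case: x Pk => [i|] //=; have := size_scale_leq b P; rewrite mul_polyC.
by move: (size P) (size (polyseq (_ *: _))); lia.
Qed.

Lemma ballN x m r : ball x m r -> ball x m (- r).
Proof.
move=> /(ball_scale (-1)); by rewrite /locC !rmorphN1 mulN1r.
Qed.

Lemma ball0 (i0 : 'I_n) x m : ball x m 0.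
Proof.
suff [k mk] : exists k, m <= height x k.
  by exists 0, k; rewrite rmorph0 mul0r size_poly0; split=> //; case: x mk => //=; lia.
case: x => [i|]; [exists (delta i *+ `|m|) | exists (- delta i0 *+ `|m|)].
  by rewrite heightMn height_delta eqxx /=; lia.
by rewrite heightMn heightN height_delta eqxx /=; lia.
Qed.

Hypothesis lam_unit : forall i j, i != j -> (lam i - lam j : L) \is a GRing.unit.
(** The content is that a monomial lies in no smaller ball than its height shows. At infinity,
    degrees are compared, which is exact since [locden] is monic. At a finite place, evaluation at
    [- lam i] kills one side, while the other is a product of powers of differences of the [lam],
    hence a unit. *)
Lemma ball_mon x m k : ball x m (mon k) <-> m <= height x k.
Proof.
split=> [|mk]; last first.
  by exists 1, k; rewrite rmorph1 mul1r size_poly1; split=> //; case: x mk; lia.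
move=> [P [k' [kP Pk']]].
(* Denominators are cleared by splitting [k' i - k i] into natural parts; the vanishing clause keeps
   the factor at place [i] out of [locden lam b]. *)
have dec (z : int) : exists ab : nat * nat,
    z = ab.1%:Z - ab.2%:Z /\ (0 <= z -> ab.2 = 0%N).
  by case: z => u; [exists (u, 0%N) | exists (0%N, u.+1)]; split=> //=; lia.
have [f fP] := choice (fun i => dec (k' i - k i)).
pose a := [ffun i => (f i).1]; pose b := [ffun i => (f i).2].
have ab : locden lam b = P * locden lam a.
  apply: (@locpoly_inj _ _ lam); rewrite rmorphM /= -!mon_nat.
  have -> : [ffun i => (a i)%:Z] = k' + (- k + [ffun i => (b i)%:Z]).
    by apply/ffunP => i; have [] := fP i; rewrite !ffunE addrA => -> _; rewrite subrK.
  by rewrite !monD mulrA -kP mulrA (mulrC (mon k)) monVl mul1r.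
case: x Pk' => [i|] /=; rewrite ?addr0.
  move=> mk'; rewrite leNgt; apply/negP => km.
  have kk' : k i < k' i by apply: lt_le_trans mk'.
  have [fi f0] := fP i.
  have ai : (0 < a i)%N.
    by rewrite ffunE; move: kk'; rewrite -subr_gt0 fi; move: (f i) => [u v] /=; lia.
  move/(congr1 (horner^~ (- lam i))): ab.
  have -> : locden lam a = ('X + (lam i)%:P) * ('X + (lam i)%:P) ^+ (a i).-1 *
      \prod_(j | j != i) ('X + (lam j)%:P) ^+ a j.
    by rewrite /locden (bigD1 i) //=; congr (_ * _); rewrite -exprS prednK.
  rewrite !(hornerM, hornerD, hornerX, hornerC) addNr !mul0r mulr0 => b0.
  suff : (locden lam b).[- lam i] \is a GRing.unit by rewrite b0 unitr0.
  rewrite horner_prod; apply: rpred_prod => j _; rewrite horner_exp hornerD hornerX hornerC.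
  have [->|ji] := eqVneq j i; last by rewrite addrC unitrX // lam_unit.
  by rewrite ffunE f0 ?expr0 ?unitr1 // subr_ge0 ltW.
have P0 : P != 0.
  by apply/eqP => P0; have := monic_neq0 (locden_monic lam b); rewrite ab P0 mul0r eqxx.
have := size_Mmonic P0 (locden_monic lam a); rewrite -ab !size_locden addnS /=.
have : height None k - height None k' = (\sum_(i < n) a i)%N%:Z - (\sum_(i < n) b i)%N%:Z.
  rewrite /height opprK addrC -sumrB !(big_morph Posz PoszD (erefl 0)) -sumrB.
  by apply: eq_bigr => i _; rewrite !ffunE; have [] := fP i.
move: (size P) (\sum_i a i)%N (\sum_i b i)%N; lia.
Qed.
End Monomials.

Arguments height : simpl never.

(** * The group in coordinates [(k, P)] and the lower length bound *)

Lemma affmx_inj (R : comUnitRingType) (a b a' b' : R) :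
  affmx a b = affmx a' b' -> a = a' /\ b = b'.
Proof.
move=> /(@eq_block_mx _ 1 1 1 1)[/matrixP/(_ 0 0) + /matrixP/(_ 0 0)].
by rewrite !mxE !mulr1n.
Qed.

Lemma affmxV (R : comUnitRingType) (a b : R) : a \is a GRing.unit ->
  (affmx a b)^-1 = affmx a^-1 (- (a^-1 * b)).
Proof.
move=> Ua; have e : affmx a^-1 (- (a^-1 * b)) * affmx a b = 1.
  by rewrite affmxM mulVr // subrr affmx1.
have [_ U] := mulmx1_unit e.
by rewrite -[LHS]mul1r -e mulrK.
Qed.

Section Elements.
Variables (L : comUnitRingType) (n : nat) (lam : 'I_n -> L).
Hypothesis lam_unit : forall i j, i != j -> (lam i - lam j : L) \is a GRing.unit.
Local Notation R := (locring lam).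
Local Notation mon := (mon lam).
Local Notation S := (gamma_gen lam).
Implicit Types (k l : {ffun 'I_n -> int}) (x : option 'I_n) (P Q : R).

Lemma mon_inj : injective mon.
Proof.
move=> k l kl; apply/ffunP => i; apply/eqP; rewrite eq_le.
have le k' l' : mon k' = mon l' -> k' i <= l' i.
  move=> e; apply/(ball_mon lam_unit (Some i) (k' i) l').
  by rewrite -e; apply/ball_mon.
by rewrite !le.
Qed.

Fact el_subproof k P : affmx (mon k) P \in gamma_mx (lam := lam).
Proof. by apply/asboolP; exists k, P. Qed.

Definition el k P : gamma lam := Gamma (el_subproof k P).

Lemma elM k P l Q : (el k P * el l Q)%g = el (k + l) (mon k * Q + P).
Proof. by apply: val_inj; rewrite /= affmxM monD. Qed.

Lemma el0 : el 0 0 = 1%g.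
Proof. by apply: val_inj; rewrite /= mon0 affmx1. Qed.

Lemma elX l m : (el l 0 ^+ m)%g = el (l *+ m) 0.
Proof.
elim: m => [|m IH]; first by rewrite expg0 mulr0n el0.
by rewrite expgS IH elM mulr0 addr0 mulrS.
Qed.

Lemma elP (g : gamma lam) : exists kP, g = el kP.1 kP.2.
Proof.
have /asboolP[k [P gE]] := valP g; exists ([ffun i => k i], P).
apply: val_inj; rewrite /= gE; congr affmx.
by apply: eq_bigr => i _; rewrite ffunE.
Qed.

Lemma el_inj k P l Q : el k P = el l Q -> k = l /\ P = Q.
Proof. by move=> /(congr1 val)/affmx_inj[/mon_inj]. Qed.

Lemma genD i b : S (el (delta i) (locC lam b)).
Proof. by left; exists i, b; left; rewrite /= mon_delta. Qed.

Lemma genN i b : S (el (- delta i) (- (mon (- delta i) * locC lam b))).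
Proof.
by left; exists i, b; right; rewrite /= affmxV ?loctD_unit // !mon_deltaN.
Qed.

Lemma genB i j b : i != j ->
  S (el (delta i - delta j) (- locC lam b * mon (- delta j))).
Proof.
by right; exists i, j, b; split; rewrite //= monD !mon_deltaN mon_delta.
Qed.

(** All that the lower bound uses about generators: [y] is the only height that may drop, by one,
    and the translation part stays in any ball around 0 that the heights of both endpoints allow. *)
Lemma gen_elim s : S s -> exists l Q y,
  [/\ s = el l Q, forall x, - height x l <= (x == y)%:Z &
    forall k x (m : int), m <= height x k -> m <= height x (k + l) ->
      ball x m (mon k * Q)].
Proof.
case=> [[i [b [sE|sE]]]|[i [j [b [ij sE]]]]].
- exists (delta i), (locC lam b), None; split.
  + by apply: val_inj; rewrite /= mon_delta.
  + by move=> x; rewrite height_delta; case: x => [i'|] //=; case: eqP => /=; lia.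
  + by move=> k x m mk _; rewrite mulrC; apply/ball_scale/ball_mon.
- exists (- delta i), (- (mon (- delta i) * locC lam b)), (Some i); split.
  + by apply: val_inj; rewrite /= sE affmxV ?loctD_unit // !mon_deltaN.
  + by move=> x; rewrite heightN height_delta; case: x => [i'|] //=; case: eqP => /=; lia.
  + move=> k x m _ mk; rewrite mulrN mulrA -monD mulrC.
    exact/ballN/ball_scale/ball_mon.
- exists (delta i - delta j), (- locC lam b * mon (- delta j)), (Some j); split.
  + by apply: val_inj; rewrite /= monD !mon_deltaN mon_delta.
  + move=> x; rewrite heightD heightN !height_delta.
    by case: x => [i'|] //=; do 2?case: eqP => /=; lia.
  + move=> k x m; rewrite addrA !heightD heightN !height_delta => mk mkl.
    rewrite mulNr mulrN mulrCA -monD; apply/ballN/ball_scale/ball_mon => //.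
    rewrite heightD heightN height_delta.
    have [xi|xi] := eqVneq x (Some i); move: mk mkl; rewrite ?xi ?(negbTE xi) /=.
      have -> /= : (Some i == Some j) = false by apply: negbTE.
      by move: (height _ k) {xi}; lia.
    by move: (height _ k); case: (x == Some j); case: (x == None) => /=; lia.
Qed.

Variable i0 : 'I_n.

Lemma walk_heights (k : nat) P N : walk S 1%g (el 0 P) N ->
  (forall x, ~ ball x (1 - k%:Z) P) -> ((n + 3) * k <= N)%N.
Proof.
move=> [p [pp pl ps]] Pfar.
have [ex exE] := choice elP.
have exP k' P' : ex (el k' P') = (k', P').
  by have /el_inj[] := exE (el k' P'); case: (ex _) => /= u v <- <-.
pose st t := nth 1%g (1%g :: p) t.
have step t : (t < N)%N -> S ((st t)^-1 * st t.+1)%g.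
  by rewrite -ps => tp; apply/set_mem/(pathP 1%g pp).
have stepE t : (t < N)%N -> exists l Q y,
   [/\ ex (st t.+1) = ((ex (st t)).1 + l, mon (ex (st t)).1 * Q + (ex (st t)).2),
     forall x, - height x l <= (x == y)%:Z &
    forall k x (m : int), m <= height x k -> m <= height x (k + l) ->
      ball x m (mon k * Q)].
  move=> /step/gen_elim[l [Q [y [e yP QP]]]]; exists l, Q, y; split=> //.
  by rewrite -exP -elM -exE -e mulVKg.
have st0 : ex (st 0) = (0, 0) by rewrite /st /= -el0 exP.
have stN : ex (st N) = (0, P) by rewrite -ps /st -last_nth pl exP.
have := @heights_bound _ N (fun t x => height x (ex (st t)).1) k (Some i0).
rewrite card_option card_ord addSn -addnS; apply.
- by move=> x; rewrite st0 height0.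
- by move=> x; rewrite stN height0.
- by move=> t; apply: sum_height.
- move=> t /stepE[l [Q [y [-> yP _]]]]; exists y => x.
  by rewrite /= heightD opprD addrA subrr sub0r.
(* If height [x] never reached [- k], every increment of the translation part, and hence [P], would
   lie in the ball of index [1 - k] at [x]. *)
move=> x; apply: contrapT => high; apply: (Pfar x).
have {}high t : (t <= N)%N -> 1 - k%:Z <= height x (ex (st t)).1.
  move=> tN; rewrite leNgt; apply/negP => low; apply: high; exists t => //; lia.
rewrite -[P]/((0 : {ffun 'I_n -> int}, P).2) -stN.
suff : forall t, (t <= N)%N -> ball x (1 - k%:Z) (ex (st t)).2 by apply.
elim=> [|t IH] tN; first by rewrite st0; apply: ball0.
have [l [Q [_ [e _ QP]]]] := stepE t tN; rewrite e; apply: ballD.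
  by apply: QP; [|have := high _ tN; rewrite e]; rewrite ?high // ltnW.
exact/IH/ltnW.
Qed.

(** * Explicit short walks and the conclusion *)

Lemma gen_pureD i : S (el (delta i) 0).
Proof. by have := genD i 0; rewrite /locC !rmorph0. Qed.

Lemma gen_pureN i : S (el (- delta i) 0).
Proof. by have := genN i 0; rewrite /locC !rmorph0 mulr0 oppr0. Qed.

Lemma gen_pureB i j : i != j -> S (el (delta i - delta j) 0).
Proof. by move=> /(genB 0); rewrite /locC !rmorph0 oppr0 mul0r. Qed.

Lemma walk_straight l k P m : S (el l 0) -> walk S (el k P) (el (k + l *+ m) P) m.
Proof.
move=> Sl; elim: m => [|m IH]; first by rewrite mulr0n addr0; apply: walk0.
rewrite -addn1; apply: walk_trans IH _.
have := walk_gen (el (k + l *+ m) P) Sl.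
by rewrite elM mulr0 add0r -addrA -mulrSr addn1.
Qed.

Lemma walk_lamp k P : walk S (el k P) (el k (P + mon k)) 2.
Proof.
rewrite -[2%N]/(1 + 1)%N.
apply: walk_trans (walk_gen _ (genD i0 1)) _.
have := walk_gen (el k P * el (delta i0) (locC lam 1))%g (gen_pureN i0).
by rewrite !elM addrK mulr0 add0r /locC !rmorph1 mulr1 (addrC P).
Qed.

(** The generators with diagonal [delta i - delta j] pass from one corner [- delta i *+ k] to the
    next in [k] steps rather than [2 * k]; each summand costs two more steps. *)
Lemma walk_tour (k : nat) i (s : seq 'I_n) P : uniq (i :: s) ->
  walk S (el 0 P)
    (el (- delta (last i s) *+ k) (P + \sum_(j <- i :: s) mon (- delta j *+ k)))
    ((k + 2) * (size s).+1).
Proof.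
move=> us; rewrite big_cons mulnS.
apply: (@walk_trans _ _ (el (- delta i *+ k) (P + mon (- delta i *+ k)))).
  apply: walk_trans (walk_lamp _ _).
  by have := walk_straight 0 P k (gen_pureN i); rewrite add0r.
rewrite addrA; move: (P + mon _) => {}P.
elim: s i P us => [|j s IH] i P /=.
  by rewrite big_nil addr0 muln0 => _; apply: walk0.
rewrite inE negb_or -andbA => /and3P[ij _ us].
rewrite mulnS big_cons addrA; apply: walk_trans (IH _ _ us).
apply: walk_trans (walk_lamp _ _).
have := walk_straight (- delta i *+ k) P k (gen_pureB ij).
by rewrite -mulrnDl addrA addNr add0r.
Qed.

Definition far_exp (k : nat) x : {ffun 'I_n -> int} :=
  if x is Some i then - delta i *+ k else delta i0 *+ k.

Definition far (k : nat) : R := \sum_x mon (far_exp k x).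

Lemma farE (k : nat) : far k = mon (delta i0 *+ k) + \sum_i mon (- delta i *+ k).
Proof.
rewrite /far (bigD1 None) //= (reindex_omap Some id) /=; last by case.
by congr (_ + _); apply: eq_bigl => i; rewrite eqxx.
Qed.

(** At each place exactly one summand has height [- k]; the others have height at least 0 and cannot
    cancel it. *)
Lemma far_nball (k : nat) x : (0 < k)%N -> ~ ball x (1 - k%:Z) (far k).
Proof.
move=> k0 Bx.
have hx : height x (far_exp k x) = - k%:Z.
  by case: x {Bx} => [i|] /=; rewrite heightMn ?heightN height_delta eqxx /=; lia.
suff : ball x (1 - k%:Z) (mon (far_exp k x)).
  by rewrite ball_mon // hx; lia.
rewrite -[mon _](addrK (\sum_(y | y != x) mon (far_exp k y))).
rewrite -(bigD1 (P := xpredT) (F := fun y => mon (far_exp k y)) x isT).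
apply: ballD Bx _; apply: ballN.
elim/big_ind: _ => [||y yx]; [exact: ball0|exact: ballD|].
apply/ball_mon => //.
suff : 0 <= height x (far_exp k y) by lia.
case: y yx => [i|] /=; rewrite heightMn ?heightN height_delta eq_sym => /negbTE->.
  by case: (x == _) => /=; lia.
by case: (x == _) => /=; lia.
Qed.

Lemma last_tour : exists i (s : seq 'I_n),
  [/\ uniq (i :: s), last i s = i0 & perm_eq (i :: s) (enum 'I_n)].
Proof.
have i0e : i0 \in enum 'I_n by rewrite mem_enum.
pose r := rem i0 (enum 'I_n).
have pr : perm_eq (rcons r i0) (enum 'I_n).
  by rewrite (perm_trans (_ : perm_eq _ (i0 :: r))) ?perm_rcons // perm_sym perm_to_rem.
have ur : uniq (rcons r i0) by rewrite (perm_uniq pr) enum_uniq.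
have lr := last_rcons i0 r i0.
by case: (rcons r i0) (size_rcons r i0) pr ur lr => // i s _; exists i, s.
Qed.

Let bound (k : nat) := ((n + 2) * k + 2 * n.+1)%N.

(** Both walks use a tour ending at [i0]. The first tours, then climbs [2 * k] steps along
    [delta i0] and adds the last summand there; the second climbs and adds that summand, returns,
    then tours. *)
Lemma walk_far (k : nat) :
  walk S 1%g (el (delta i0 *+ k) (far k)) (bound k) /\
  walk S 1%g (el (- delta i0 *+ k) (far k)) (bound k).
Proof.
have [i [s [us ls pis]]] := last_tour.
have ss : (size s).+1 = n by rewrite -[LHS]/(size (i :: s)) (perm_size pis) size_enum_ord.
have sumE : \sum_(j <- i :: s) mon (- delta j *+ k) = \sum_j mon (- delta j *+ k).
  by rewrite (perm_big _ pis) /= big_enum.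
have tour P := walk_tour k P us; rewrite ls sumE ss in tour.
have up P := walk_straight 0 P k (gen_pureD i0); rewrite add0r in up.
have upN P := walk_straight (- delta i0 *+ k) P k (gen_pureD i0).
rewrite -mulrnDl addNr mul0rn in upN.
have down P := walk_straight (delta i0 *+ k) P k (gen_pureN i0).
rewrite -mulrnDl addrN mul0rn in down.
rewrite -el0 farE /bound; split.
  have -> : ((n + 2) * k + 2 * n.+1 = (k + 2) * n + k + k + 2)%N by lia.
  rewrite addrC; apply: walk_trans (walk_lamp _ _); apply: walk_trans (up _).
  by apply: walk_trans (upN _); have := tour 0; rewrite add0r.
have -> : ((n + 2) * k + 2 * n.+1 = k + 2 + k + (k + 2) * n)%N by lia.
apply: walk_trans (tour _); apply: walk_trans (down _).
by apply: walk_trans (up 0) _; have := walk_lamp (delta i0 *+ k) 0; rewrite add0r.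
Qed.

Lemma infinite_cone_types_gamma :
  infinite_set [set cone_type S g | g in [set: gamma lam]].
Proof.
apply: (infinite_cone_types (gen_pureN i0)) => J.
pose C := (2 * n.+1)%N; pose K := (J.+1 * C.+1)%N.
pose g0 := el (delta i0 *+ K) (far K); pose s := el (- delta i0) 0.
pose f t := cayley_dist S 1%g (g0 * s ^+ t)%g.
have gsE t : (g0 * s ^+ t)%g = el (delta i0 *+ K - delta i0 *+ t) (far K).
  by rewrite elX elM mulr0 add0r mulNrn.
have [w0 w2] := walk_far K.
(* Reachability makes [cayley_dist] the true distance here rather than its default value 0. *)
have wf t : exists m, walk S 1%g (g0 * s ^+ t)%g m.
  exists (bound K + t)%N; apply: walk_trans w0 _.
  by rewrite gsE -mulNrn; apply: walk_straight; apply: gen_pureN.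
have f_step t : (f t.+1 <= (f t).+1)%N.
  have [m wm] := wf t; apply: dist_le; rewrite -[(f t).+1]addn1 expgSr mulgA.
  by apply: walk_trans (distP wm) _; apply: walk_gen; apply: gen_pureN.
have f0 : (f 0 <= bound K)%N by rewrite /f expg0 mulg1; apply: dist_le.
have f2 : (f (2 * K) <= bound K)%N.
  by rewrite /f gsE mul2n -addnn mulrnDr opprD addrA subrr sub0r -mulNrn; apply: dist_le.
have f1 : (bound K + K <= f K + C)%N.
  have [m /distP] := wf K; rewrite -/(f K) gsE subrr => /walk_heights.
  move=> /(_ K)/(_ (fun x => @far_nball K x isT)).
  by rewrite /bound -/C; lia.
have [a [aup [m am]]] := long_run f_step f0 f1 f2.
exists (g0 * s ^+ a)%g; have fE j : cayley_dist S 1%g (g0 * s ^+ a * s ^+ j)%g = f (a + j)%N.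
  by rewrite -mulgA -expgnDr.
split=> [j jJ|]; first by rewrite !fE addnS aup.
by exists m; rewrite !fE addnS.
Qed.

End Elements.

Theorem theorem15 (d q : nat) (hd : (2 <= d)%N) (hq : (2 <= q)%N)
    (hdq : d = 2%N \/ d = 3%N \/
       ((4 <= d)%N /\ forall p : nat, prime p -> (p %| q)%N -> (d - 1 < p)%N))
    (L : finComUnitRingType) (cardL : #|L| = q)
    (lam : 'I_(d - 1) -> L) (lam_inj : injective lam)
    (lam_unit : (3 <= d)%N ->
       forall i j : 'I_(d - 1), i != j -> lam i - lam j \is a GRing.unit) :
  infinite_set [set cone_type (gamma_gen lam) g | g in [set: gamma lam]].
Proof.
have d1 : (0 < d - 1)%N by lia.
apply: (infinite_cone_types_gamma _ (Ordinal d1)) => i j ij.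
(* For [d = 2] there is a single index, so distinct [i] and [j] force [3 <= d]. *)
apply: lam_unit => //; rewrite ltnNge; apply/negP => d2; case/eqP: ij.
by apply: ord_inj; have := ltn_ord i; have := ltn_ord j; lia.
Qed.
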